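(* Let $G$ be a graph on $n$ vertices and $\overline{G}$ its complement. (a) If $n \ge 5$, then $3 \le \operatorname{fd}(G) + \operatorname{fd}(\overline{G}) \le 2n-4$, and both bounds are sharp (for each $n \ge 5$ there are graphs on $n$ vertices attaining each bound). (b) If $n \ge 4$, then $2 \le \operatorname{fd}(G)\cdot \operatorname{fd}(\overline{G}) \le (n-2)^2$, and both bounds are sharp (for each $n \ge 4$ there are graphs on $n$ vertices attaining each bound).
   Context: All graphs are finite and simple; $N(v)$ denotes the open neighborhood of $v$. For a graph $G=(V,E)$ and an integer $k \ge 1$, a $k$-fair dominating set is a dominating set $D \subseteq V$ such that $|N(v) \cap D| = k$ for every $v \in V \setminus D$ (the set $D = V$ qualifies vacuously). A fair dominating set (FD-set) is a set that is a $k$-fair dominating set for some $k \ge 1$. If $G$ has at least one edge, $\operatorname{fd}(G)$ is the minimum cardinality of an FD-set of $G$; by convention, $\operatorname{fd}(\overline{K_n}) = n$ for the edgeless graph on $n$ vertices. *)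

(* Defs.v *)
From mathcomp Require Import all_boot.

Set Implicit Arguments.
Unset Strict Implicit.
Unset Printing Implicit Defensive.

Record sgraph := SGraph {
  vertex :> finType;
  adj : rel vertex;
  adj_sym : symmetric adj;
  adj_irrefl : irreflexive adj
}.

Section Complement.
Variable G : sgraph.

Definition compl_adj : rel G := fun u v => (u != v) && ~~ adj u v.

Lemma compl_adj_sym : symmetric compl_adj.
Proof. by move=> u v; rewrite /compl_adj eq_sym adj_sym. Qed.

Lemma compl_adj_irrefl : irreflexive compl_adj.
Proof. by move=> u; rewrite /compl_adj eqxx. Qed.

Definition compl : sgraph := SGraph compl_adj_sym compl_adj_irrefl.
End Complement.

Section FairDomination.
Variable G : sgraph.
Implicit Types (v : G) (D : {set G}).

Definition nbh v : {set G} := [set w | adj v w].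

Definition dominating D : bool :=
  [forall v, (v \notin D) ==> [exists w in D, adj v w]].

Definition fair_dominating (k : nat) D : bool :=
  dominating D && [forall v, (v \notin D) ==> (#|nbh v :&: D| == k)].

(* The search is over k = i.+1 with i <= #|G|, to get a boolean; by [fd_setP]
   the upper bound on k is harmless. *)
Definition fd_set D : bool :=
  [exists i : 'I_#|G|.+1, fair_dominating i.+1 D].

Lemma fair_dominating_setT k : fair_dominating k [set: G].
Proof.
by apply/andP; split; apply/forallP => v; rewrite in_setT.
Qed.

Lemma fd_setP D :
  reflect (exists k, 1 <= k /\ fair_dominating k D) (fd_set D).
Proof.
apply: (iffP existsP) => [[i fD] | [[|k] [// _ fD]]]; first by exists i.+1.
have [lt_k | le_k] := ltnP k #|G|.+1; first by exists (Ordinal lt_k).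
have -> : D = [set: G].
  apply/setP => v; rewrite in_setT; apply: contraT => vD.
  case/andP: fD => _ /forallP/(_ v); rewrite vD => /eqP kE.
  have := max_card (mem (nbh v :&: D)).
  by rewrite kE ltnNge ltnW.
by exists ord0; apply: fair_dominating_setT.
Qed.

Definition has_edge : bool := [exists u : G, [exists v : G, adj u v]].

(* The default of the [arg min], the whole vertex set, is always an FD-set. *)
Definition fd : nat :=
  if has_edge then #|[arg min_(D < [set: G] | fd_set D) #|D|]| else #|G|.

Lemma fdP : has_edge ->
  (exists2 D, fd_set D & #|D| = fd) /\ (forall D, fd_set D -> fd <= #|D|).
Proof.
rewrite /fd => ->; case: arg_minnP => [|D fD minD].
  by apply/existsP; exists ord0; apply: fair_dominating_setT.
by split; first by exists D.
Qed.

End FairDomination.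

(* Main.v *)
Require Import Defs.
From mathcomp Require Import all_boot.
From mathcomp Require Import zify.

(** If [G] has an isolated vertex, its complement has a universal vertex, so
    one of the two numbers is 1 and the other at most [n]. Otherwise two
    vertices of [G] have equal degree and do not form a [K_2] component (degrees
    range over [1, n-1], and a [K_2] component leaves only [1, n-3] for the
    remaining vertices); the complement of this pair is an FD-set, so
    [fd G <= n - 2], and likewise for the complement graph.

    Call [D] constant if all vertices outside [D] have the same number of
    neighbours in [D]. This property is invariant under graph complementation,
    and FD-sets are constant. Hence both numbers are at least [n - 2] for a
    graph in which no nonempty [D] missing at least three vertices is constant.
    A split graph with clique [K] and independent set [I] works when at most two
    vertices of [K], and at most two of [I], have the same degree, and when the
    bipartite graph between [K] and [I] is indecomposable. The lower bounds are
    attained by the disjoint union of a star and an isolated vertex. *)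

Set Implicit Arguments.
Unset Strict Implicit.
Unset Printing Implicit Defensive.

(** Pigeonhole: [#|A|] distinct values do not fit into [[1, #|A| - 1]], an interval of [#|A|.-1]
    elements. *)
Lemma inj_in_range_eq_set0 (T : finType) (A : {set T}) (f : T -> nat) :
  {in A &, injective f} -> (forall x, x \in A -> 0 < f x < #|A|) ->
  A = set0.
Proof.
move=> f_inj f_rng; apply/eqP; rewrite -cards_eq0.
have un : uniq (map f (enum A)).
  by rewrite map_inj_in_uniq ?enum_uniq // => x y; rewrite !mem_enum; apply: f_inj.
have /(uniq_leq_size un) : {subset map f (enum A) <= iota 1 #|A|.-1}.
  move=> _ /mapP[x + ->]; rewrite mem_enum => /f_rng.
  by rewrite mem_iota; lia.
by rewrite size_map size_iota -cardE; lia.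
Qed.

(** * FD-sets and vertex degrees in a single graph *)

Section Graph.
Variable G : sgraph.
Implicit Types (u v w : G) (D : {set G}).

Lemma fd_set_const (k : nat) D : 0 < k ->
  (forall v, v \notin D -> #|nbh v :&: D| = k) -> fd_set D.
Proof.
move=> k_gt0 Dk; apply/fd_setP; exists k; split=> //; apply/andP; split.
  apply/forallP => v; apply/implyP => /Dk Dv.
  have /set0Pn[w] : nbh v :&: D != set0 by rewrite -cards_eq0 Dv; lia.
  by rewrite !inE => /andP[vw Dw]; apply/existsP; exists w; rewrite Dw.
by apply/forallP => v; apply/implyP => /Dk ->.
Qed.

Lemma fd_set_nbh D : fd_set D ->
  exists2 k, 0 < k & forall v, v \notin D -> #|nbh v :&: D| = k.
Proof.
move=> /fd_setP[k [k_gt0 /andP[_ /forallP Dk]]]; exists k => // v vD.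
by apply/eqP; apply: (implyP (Dk v)).
Qed.

Lemma has_edgeI u v : adj u v -> has_edge G.
Proof. by move=> uv; apply/existsP; exists u; apply/existsP; exists v. Qed.

Lemma fd_le_card : fd G <= #|G|.
Proof.
case: (boolP (has_edge G)) => [/fdP[[D _ <-] _]|nE]; first exact: max_card.
by rewrite /fd (negPf nE).
Qed.

Lemma fd_gt0 : 0 < #|G| -> 0 < fd G.
Proof.
move=> /card_gt0P[v _].
case: (boolP (has_edge G)) => [/fdP[[D /fd_set_nbh[k k_gt0 Dk] <-] _]|nE].
  rewrite lt0n cards_eq0; apply/eqP => D0.
  have := Dk v; rewrite D0 inE setI0 cards0 => /(_ isT); lia.
by rewrite /fd (negPf nE); apply/card_gt0P; exists v.
Qed.

(** The singleton of a universal vertex is 1-fair. *)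
Lemma fd_universal v : 1 < #|G| -> (forall w, w != v -> adj v w) ->
  fd G <= 1.
Proof.
move=> n_gt1 v_univ.
have [w wv] : exists w, w != v.
  have : 0 < #|[set~ v]| by rewrite cardsC1; lia.
  by move=> /card_gt0P[w]; rewrite !inE; exists w.
have [_ minD] := fdP (has_edgeI (v_univ w wv)).
rewrite -(cards1 v); apply: minD; apply: (@fd_set_const 1) => // x.
rewrite inE => xv; rewrite (_ : _ :&: _ = [set v]) ?cards1 //.
apply/setP => y; rewrite !inE; case: eqVneq => [->|]; last by rewrite andbF.
by rewrite adj_sym v_univ.
Qed.

Lemma universal_of_fd : 1 < #|G| -> fd G <= 1 ->
  exists v, forall w, w != v -> adj v w.
Proof.
move=> n_gt1 fd1; have fd_pos : 0 < fd G by apply: fd_gt0; lia.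
case: (boolP (has_edge G)) => [/fdP[[D /fd_set_nbh[k k_gt0 Dk] Dfd] _]|nE].
  have /cards1P[v Dv] : #|D| == 1 by rewrite Dfd; lia.
  exists v => w wv; have := Dk w; rewrite Dv inE wv => /(_ isT) kE.
  have /card_gt0P[x] : 0 < #|nbh w :&: [set v]| by rewrite kE.
  by rewrite !inE => /andP[wx /eqP xv]; rewrite adj_sym -xv.
by move: fd1; rewrite /fd (negPf nE); lia.
Qed.

Lemma card_nbh_setC2 u v : u != v ->
  #|nbh u :&: ~: [set u; v]| + adj u v = #|nbh u|.
Proof.
move=> uv; rewrite -(cardsID [set u; v] (nbh u)) addnC -setDE; congr (_ + _).
case: (boolP (adj u v)) => [a|/negPf a].
  rewrite (_ : _ :&: _ = [set v]) ?cards1 //; apply/setP => x; rewrite !inE.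
  case: (eqVneq x u) => [->|_]; first by rewrite adj_irrefl (negPf uv).
  by case: (eqVneq x v) => [->|_]; rewrite ?a ?andbF.
rewrite (_ : _ :&: _ = set0) ?cards0 //; apply/setP => x; rewrite !inE.
case: (eqVneq x u) => [->|_]; first by rewrite adj_irrefl.
by case: (eqVneq x v) => [->|_]; rewrite ?a ?andbF.
Qed.

(* Two vertices of equal degree form the complement of an FD-set unless they
   are the two ends of a [K_2] component. *)
Lemma fd_eq_degree u v : u != v -> #|nbh u| = #|nbh v| ->
  adj u v < #|nbh u| -> fd G <= #|G| - 2.
Proof.
move=> uv duv lt_d; have /card_gt0P[w] : 0 < #|nbh u| by lia.
rewrite inE => uw; have [_ minD] := fdP (has_edgeI uw).
have <- : #|~: [set u; v]| = #|G| - 2 by rewrite cardsCs setCK cards2 uv.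
apply/minD/(@fd_set_const (#|nbh u| - adj u v)); first by lia.
move=> x; rewrite inE negbK !inE => /orP[/eqP->|/eqP->].
  by have := card_nbh_setC2 uv; lia.
have := @card_nbh_setC2 v u; rewrite eq_sym setUC (adj_sym v u) => /(_ uv).
lia.
Qed.

Lemma exists_eq_degree : 2 < #|G| -> (forall v, 0 < #|nbh v|) ->
  exists u v, [/\ u != v, #|nbh u| = #|nbh v| & adj u v < #|nbh u|].
Proof.
move=> n_gt2 d_gt0.
have [/existsP[u /existsP[v /and3P[uv /eqP duv lt]]]|] := boolP [exists u : G,
    [exists v : G, [&& u != v, #|nbh u| == #|nbh v| & adj u v < #|nbh u|]]].
  by exists u, v.
rewrite negb_exists => /forallP H; exfalso.
(* Arguing by contradiction, any two vertices of equal degree form a [K_2] component. *)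
have K2 u v : u != v -> #|nbh u| = #|nbh v| -> adj u v /\ #|nbh u| = 1.
  move=> uv duv; have := H u; rewrite negb_exists => /forallP/(_ v).
  rewrite uv duv eqxx /= -leqNgt; have := d_gt0 v.
  by case: (adj u v); lia.
have [|/injectivePn] := boolP (injectiveb (fun v => #|nbh v|)).
  move=> /injectiveP d_inj.
  have /eqP : [set: G] = set0.
    apply: (@inj_in_range_eq_set0 _ _ (fun v => #|nbh v|)) => [x y _ _|x _].
      exact: d_inj.
    rewrite d_gt0 /= cardsT -(cardsC (nbh x)) -[ltnLHS]addn0 ltn_add2l.
    by apply/card_gt0P; exists x; rewrite !inE adj_irrefl.
  by rewrite -cards_eq0 cardsT; lia.
move=> [u [v vu duv]] {H}; have [uv du1] := K2 u v vu duv.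
have dv1 : #|nbh v| = 1 by rewrite -duv.
have nbu w : adj u w -> w = v.
  move: du1 => /eqP/cards1P[x /setP xE].
  move: (xE w) (xE v); rewrite !inE uv => -> /esym/eqP->; exact/eqP.
have nbv w : adj v w -> w = u.
  move: dv1 => /eqP/cards1P[x /setP xE].
  move: (xE w) (xE u); rewrite !inE (adj_sym v u) uv => -> /esym/eqP->; exact/eqP.
have cA : #|~: [set u; v]| = #|G| - 2 by rewrite cardsCs setCK cards2 vu.
(* Pigeonhole again, away from the [K_2] component on [u] and [v]. Two further vertices of equal
   degree would have degree 1, hence the degree of [u], and so be adjacent to [u]. The neighbours of
   [x] avoid [u], [v] and [x] itself, so its degree is below [#|G| - 2]. *)
have /eqP : ~: [set u; v] = set0.
  apply: (@inj_in_range_eq_set0 _ _ (fun v => #|nbh v|)) => [x y|x].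
    rewrite !inE !negb_or => /andP[xu xv] _ dxy; apply/eqP.
    have [//|xy] := eqVneq x y; have [_ dx1] := K2 x y xy dxy.
    have [||/nbu xv' _] := K2 u x; rewrite ?du1 ?dx1 //; first by rewrite eq_sym.
    by rewrite xv' eqxx in xv.
  move=> xA; rewrite d_gt0 /=; apply: proper_card; apply/properP.
  split; last by exists x => //; rewrite inE adj_irrefl.
  apply/subsetP => y; rewrite !inE => xy; apply/norP; split.
    apply/eqP => yu; move: xA; rewrite !inE; move: xy; rewrite yu adj_sym.
    by move=> /nbu->; rewrite eqxx orbT.
  apply/eqP => yv; move: xA; rewrite !inE; move: xy; rewrite yv adj_sym.
  by move=> /nbv->; rewrite eqxx.
by rewrite -cards_eq0 cA; lia.
Qed.

Lemma fd_le_sub2 : 2 < #|G| -> (forall v, 0 < #|nbh v|) -> fd G <= #|G| - 2.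
Proof.
by move=> n_gt2 /(exists_eq_degree n_gt2)[u [v [uv duv lt]]]; apply: fd_eq_degree lt.
Qed.

(** This makes constancy of [D] pass between a graph and its complement, with [c] replaced by
    [#|D| - c]. *)
Lemma card_nbh_compl v D : v \notin D ->
  #|nbh v :&: D| + #|nbh (v : compl G) :&: D| = #|D|.
Proof.
move=> vD; rewrite -(cardsID (nbh v) D) setIC; congr (_ + #|pred_of_set _|).
apply/setP => x; rewrite !inE /= /compl_adj.
by case: (eqVneq v x) => [<-|]; rewrite ?(negPf vD) ?andbF.
Qed.

End Graph.

(** * Bounds for the sum and the product *)

Lemma fd_compl_cases (G : sgraph) : 2 < #|G| ->
  [\/ fd G <= 1, fd (compl G) <= 1
    | fd G <= #|G| - 2 /\ fd (compl G) <= #|G| - 2].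
Proof.
move=> n_gt2.
have [/existsP[v /eqP dv]|] := boolP [exists v : G, #|nbh v| == 0].
  apply: Or32; apply: (@fd_universal (compl G) v); first exact: ltnW.
  move=> w wv; rewrite /= /compl_adj eq_sym wv /=.
  by move/eqP: dv; rewrite cards_eq0 => /eqP/setP/(_ w); rewrite !inE => ->.
rewrite negb_exists => /forallP d_gt0.
have [/existsP[v /eqP dv]|] := boolP [exists v : compl G, #|nbh v| == 0].
  apply: Or31; apply: (@fd_universal G v); first exact: ltnW.
  move=> w wv; move/eqP: dv; rewrite cards_eq0 => /eqP/setP/(_ w).
  by rewrite !inE /= /compl_adj eq_sym wv => /negbFE.
rewrite negb_exists => /forallP dc_gt0.
apply: Or33; split; first by apply: fd_le_sub2 => // v; rewrite lt0n.
by apply: (@fd_le_sub2 (compl G)) => // v; rewrite lt0n.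
Qed.

(** If both numbers were 1, [G] would have a universal vertex and also, through its complement, an
    isolated one. *)
Lemma fd_compl_gt2 (G : sgraph) : 1 < #|G| -> 2 < fd G + fd (compl G).
Proof.
move=> n_gt1.
have p1 : 0 < fd G by apply: fd_gt0; lia.
have p2 : 0 < fd (compl G) by apply: (@fd_gt0 (compl G)); exact: ltnW.
rewrite ltnNge; apply/negP => le2.
have [|v vE] := universal_of_fd n_gt1; first by lia.
have [|w wE] := @universal_of_fd (compl G) n_gt1; first by lia.
have [wv|vw] := eqVneq w v; last first.
  have := vE w vw; have := wE v; rewrite eq_sym /= /compl_adj => /(_ vw).
  by rewrite adj_sym => /andP[_ /negPf->].
have : 0 < #|[set~ v]| by rewrite cardsC1; lia.
move=> /card_gt0P[x]; rewrite !inE => xv.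
have := wE x; rewrite wv => /(_ xv); rewrite /= /compl_adj => /andP[_].
by rewrite vE.
Qed.

(** When one number is 1, the sum is at most [n + 1], which is within [2n - 4] from [n = 5] on. *)
Lemma fd_add_bounds (G : sgraph) : 4 < #|G| ->
  2 < fd G + fd (compl G) <= 2 * #|G| - 4.
Proof.
move=> n_gt4; apply/andP; split; first by apply: fd_compl_gt2; lia.
have := fd_le_card G; have : fd (compl G) <= #|G| := fd_le_card (compl G).
have n_gt2 : 2 < #|G| by lia.
by case: (fd_compl_cases n_gt2) => [||[]]; lia.
Qed.

Lemma fd_mul_bounds (G : sgraph) : 3 < #|G| ->
  1 < fd G * fd (compl G) <= (#|G| - 2) ^ 2.
Proof.
move=> n_gt3; have n_gt2 : 2 < #|G| by lia.
have sum_gt2 : 2 < fd G + fd (compl G) by apply: fd_compl_gt2; lia.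
have le1 := fd_le_card G.
have le2 : fd (compl G) <= #|G| := fd_le_card (compl G).
have pos1 : 0 < fd G by apply: fd_gt0; lia.
have pos2 : 0 < fd (compl G) by apply: (@fd_gt0 (compl G)); do 3 apply: ltnW.
have := fd_compl_cases n_gt2.
move: (fd G) (fd (compl G)) #|G| n_gt3 {n_gt2} sum_gt2 le1 le2 pos1 pos2.
move=> a b n n_gt3 sum_gt2 le1 le2 pos1 pos2 H.
rewrite -mulnn; apply/andP; split; first by nia.
by case: H => [||[an bn]]; [nia | nia | apply: leq_mul].
Qed.

(** * Sharpness of the lower bounds *)

Section IsolatedStar.
Variable n : nat.

(** [Some None] is the centre of the star, [None] the isolated vertex, and the [Some (Some i)] are
    the leaves. *)
Definition istar_adj : rel (option (option 'I_n)) := fun x y =>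
  match x, y with
  | Some None, Some (Some _) | Some (Some _), Some None => true
  | _, _ => false
  end.

Lemma istar_adj_sym : symmetric istar_adj.
Proof. by move=> [[x|]|] [[y|]|]. Qed.

Lemma istar_adj_irrefl : irreflexive istar_adj.
Proof. by move=> [[x|]|]. Qed.

Definition istar : sgraph := SGraph istar_adj_sym istar_adj_irrefl.

Lemma card_istar : #|istar| = n.+2.
Proof. by rewrite !card_option card_ord. Qed.

Lemma fd_istar_le : 0 < n -> fd istar <= 2.
Proof.
move=> n_gt0; pose i0 : 'I_n := Ordinal n_gt0.
have [|_ minD] := @fdP istar.
  by apply/existsP; exists (Some None); apply/existsP; exists (Some (Some i0)).
apply: leq_trans (minD ([set None; Some None] : {set istar}) _) _; last first.
  by rewrite cards2.
apply: (@fd_set_const istar 1) => // -[[x|]|]; rewrite !inE ?eqxx //= => _.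
rewrite (_ : _ :&: _ = [set Some None]) ?cards1 //.
by apply/setP => -[[y|]|]; rewrite !inE.
Qed.

Lemma fd_compl_istar_le : fd (compl istar) <= 1.
Proof.
apply: (@fd_universal (compl istar) None); first by rewrite [#|_|]card_istar.
by move=> [w|].
Qed.

End IsolatedStar.

(** * Split graphs for the upper bounds *)

Lemma card_set_sum (A B : finType) (S : {set A + B}) :
  #|S| = #|[set a | inl a \in S]| + #|[set b | inr b \in S]|.
Proof.
rewrite -!sum1_card big_sumType /=.
by congr (_ + _); apply: eq_bigl => x; rewrite !inE.
Qed.

Section HalfSplit.
Variables m q : nat.

(* The half graph [i <= j] with the edges [i = j] traded for the non-edges
   [i = j + 1]; the switch removes every decomposition of the half graph.
   For [m = 2 = q] this gives [P_4], for [m = 2], [q = 3] the bull. *)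
Definition half_rel (i j : nat) : bool := (j.+1 == i) || (i < j).

Definition hsplit_adj : rel ('I_m + 'I_q) := fun x y =>
  match x, y with
  | inl i, inl k => i != k
  | inl i, inr j | inr j, inl i => half_rel i j
  | inr _, inr _ => false
  end.

Lemma hsplit_adj_sym : symmetric hsplit_adj.
Proof. by move=> [i|j] [k|l] //=; rewrite eq_sym. Qed.

Lemma hsplit_adj_irrefl : irreflexive hsplit_adj.
Proof. by move=> [i|j] //=; rewrite eqxx. Qed.

Definition hsplit : sgraph := SGraph hsplit_adj_sym hsplit_adj_irrefl.

Lemma card_hsplit : #|hsplit| = m + q.
Proof. by rewrite card_sum !card_ord. Qed.

(** The summands count [j = i - 1] and the [j > i]. For [i < q] a value repeats only at [i = 0] and
    [i = 1]. *)
Lemma card_half_row i : #|[set j : 'I_q | half_rel i j]| = (0 < i <= q) + (q - i.+1).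
Proof.
rewrite -sum1_card (eq_bigl (fun j : 'I_q => half_rel i j)) => [|j]; last by rewrite inE.
rewrite big_mkcond /= -(big_mkord xpredT (fun j => if half_rel i j then 1 else 0)).
elim: q => [|r IH]; first by rewrite big_geq; lia.
by rewrite big_nat_recr //= IH /half_rel; case: ifP; lia.
Qed.

(** The summands count [i = j + 1] and the [i < j]. For [j <= m] a value repeats only at [j = m - 2]
    and [j = m - 1]. *)
Lemma card_half_col j : #|[set i : 'I_m | half_rel i j]| = (j.+1 < m) + minn j m.
Proof.
rewrite -sum1_card (eq_bigl (fun i : 'I_m => half_rel i j)) => [|i]; last by rewrite inE.
rewrite big_mkcond /= -(big_mkord xpredT (fun i => if half_rel i j then 1 else 0)).
elim: m => [|r IH]; first by rewrite big_geq; lia.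
by rewrite big_nat_recr //= IH /half_rel; case: ifP; lia.
Qed.

Hypotheses (m_gt1 : 1 < m) (le_mq : m <= q) (le_qm : q <= m.+1).

(* A vertex of [I] outside [D] sees at most the [K]-part of [D], a vertex of [K]
   outside [D] sees at least that; equality propagates along the chain
   [inl k, inr (k-1), inl (k-1), ...] down to [inl 0], and then everywhere. *)
Lemma hsplit_mixed (c : nat) (D : {set hsplit}) (i : 'I_m) (j : 'I_q) :
  (forall v, v \notin D -> #|nbh v :&: D| = c) ->
  inl i \notin D -> inr j \notin D -> D = set0.
Proof.
move=> Dc; pose DK := [set x : hsplit | (if x is inl _ then true else false) && (x \in D)].
have subl k : inl k \notin D -> DK \subset nbh (inl k : hsplit) :&: D.
  move=> kD; apply/subsetP => -[l|l]; rewrite !inE //= => lD; rewrite lD andbT.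
  by apply: contraNneq kD => ->.
have subr l : inr l \notin D -> nbh (inr l : hsplit) :&: D \subset DK.
  by move=> lD; apply/subsetP => -[k|k]; rewrite !inE //= => /andP[].
move=> iD jD.
have cDK : #|DK| = c.
  apply/eqP; rewrite eqn_leq -{1}(Dc _ iD) subset_leq_card ?subl //=.
  by rewrite -(Dc _ jD) subset_leq_card ?subr.
have stepl (k : 'I_m) (l : 'I_q) : inl k \notin D -> half_rel k l -> inr l \notin D.
  move=> kD kl; apply/negP => lD.
  have /eqP/setP/(_ (inr l)) : DK == nbh (inl k : hsplit) :&: D.
    by rewrite eqEcard subl //= Dc ?cDK.
  by rewrite !inE /= kl lD.
have stepr (k : 'I_m) (l : 'I_q) : inr l \notin D -> ~~ half_rel k l -> inl k \notin D.
  move=> lD /negPf kl; apply/negP => kD.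
  have /eqP/setP/(_ (inl k)) : nbh (inr l : hsplit) :&: D == DK.
    by rewrite eqEcard subr //= Dc ?cDK.
  by rewrite !inE /= kl kD.
have m_gt0 : 0 < m by lia.
have D0 : inl (Ordinal m_gt0) \notin D.
  have : forall t (tm : t < m), inl (Ordinal tm) \notin D -> inl (Ordinal m_gt0) \notin D.
    elim=> [|t IH] tm tD; first by rewrite (bool_irrelevance m_gt0 tm).
    have tm' : t < m by lia.
    have tq : t < q by lia.
    apply: (IH tm'); apply: (stepr _ (Ordinal tq)); last by rewrite /half_rel /=; lia.
    by apply: stepl tD _; rewrite /half_rel /=; lia.
  by case: i iD => t tm iD /(_ t tm iD).
have Dr (l : 'I_q) : 0 < l -> inr l \notin D.
  by move=> l_gt0; apply: stepl D0 _; rewrite /half_rel /=; lia.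
have Dl (k : 'I_m) : inl k \notin D.
  have [k0|k_gt0] := posnP k; first by rewrite (_ : k = Ordinal m_gt0) //; apply: val_inj.
  have kq : k < q by have := ltn_ord k; lia.
  by apply: (stepr _ (Ordinal kq)); [apply: Dr | rewrite /half_rel /=; lia].
apply/setP => -[k|l]; rewrite inE; first exact/negbTE/Dl.
apply/negbTE; have [l0|] := posnP l; last exact: Dr.
(* [inl 0] is not adjacent to [inr 0], which is reached from [inl 1] by a traded edge. *)
by apply: (stepl (Ordinal m_gt1)); rewrite ?Dl // /half_rel l0.
Qed.

(** If [D] contains all of [K] or all of [I], three vertices outside [D] lie on the same side and
    would have equally many neighbours on the other side; the row and column counts allow at most
    two. *)
Lemma hsplit_const (c : nat) (D : {set hsplit}) : 2 < #|~: D| ->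
  (forall v, v \notin D -> #|nbh v :&: D| = c) -> D = set0.
Proof.
move=> cD Dc.
have [/existsP[i iD]|] := boolP [exists i : 'I_m, inl i \notin D].
  have [/existsP[j jD]|] := boolP [exists j : 'I_q, inr j \notin D].
    exact: hsplit_mixed Dc iD jD.
  rewrite negb_exists => /forallP jD; exfalso.
  move: cD; rewrite card_set_sum.
  have -> : [set b : 'I_q | inr b \in ~: D] = set0.
    by apply/setP => b; rewrite !inE (negPf (jD b)).
  rewrite cards0 addn0 => /card_gt2P[x [y [z [[]]]]]; rewrite !inE => xD yD zD [xy yz zx].
  (* A clique vertex outside [D] sees all of [D] in [K] and, as [I] lies in [D], its full row. *)
  have E k : inl k \notin D -> #|[set a : 'I_m | inl a \in D]| + (0 < k <= q) + (q - k.+1) = c.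
    move=> kD; rewrite -(Dc _ kD) card_set_sum -addnA -card_half_row.
    congr (_ + _); apply: eq_card => l; rewrite !inE /=.
      by case: eqVneq => [<-|//]; rewrite (negPf kD).
    by have := jD l; rewrite negbK => ->; rewrite andbT.
  move: (E _ xD) (E _ yD) (E _ zD) xy yz zx (ltn_ord x) (ltn_ord y) (ltn_ord z).
  rewrite -!val_eqE /=; lia.
rewrite negb_exists => /forallP iD; exfalso.
move: cD; rewrite card_set_sum.
have -> : [set b : 'I_m | inl b \in ~: D] = set0.
  by apply/setP => b; rewrite !inE (negPf (iD b)).
rewrite cards0 add0n => /card_gt2P[x [y [z [[]]]]]; rewrite !inE => xD yD zD [xy yz zx].
have E l : inr l \notin D -> (l.+1 < m) + minn l m = c.
  move=> lD; rewrite -(Dc _ lD) card_set_sum -card_half_col -[LHS]addn0.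
  congr (_ + _); last by symmetry; apply: eq_card0 => k; rewrite !inE.
  by apply: eq_card => k; rewrite !inE /=; have := iD k; rewrite negbK => ->; rewrite andbT.
move: (E _ xD) (E _ yD) (E _ zD) xy yz zx (ltn_ord x) (ltn_ord y) (ltn_ord z).
rewrite -!val_eqE /=; lia.
Qed.

End HalfSplit.

(** A smaller FD-set would be constant, hence empty, and the empty set dominates nothing. An
    edgeless graph is covered by the convention for [fd]. *)
Lemma fd_ge_sub2 (G : sgraph) : 2 < #|G| ->
  (forall (c : nat) (D : {set G}), 2 < #|~: D| ->
     (forall v, v \notin D -> #|nbh v :&: D| = c) -> D = set0) ->
  #|G| - 2 <= fd G.
Proof.
move=> n_gt2 Gconst.
have [/fdP[[D /fd_set_nbh[k k_gt0 Dk] <-] _]|nE] := boolP (has_edge G); last first.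
  by rewrite /fd (negPf nE) leq_subr.
rewrite leqNgt; apply/negP => lt; have := cardsC D => cD.
have D0 : D = set0 by apply: Gconst Dk; lia.
have /card_gt0P[v _] : 0 < #|G| by lia.
by have := Dk v; rewrite D0 inE setI0 cards0 => /(_ isT); lia.
Qed.

Lemma hsplit_fd (n : nat) : 3 < n -> exists G : sgraph,
  [/\ #|G| = n, n - 2 <= fd G & n - 2 <= fd (compl G)].
Proof.
move=> n_gt3; have [h1 h2 h3] : [/\ 1 < n./2, n./2 <= n - n./2 & n - n./2 <= n./2.+1].
  by split; lia.
exists (hsplit n./2 (n - n./2)).
have cG : #|hsplit n./2 (n - n./2)| = n by rewrite card_hsplit; lia.
have G_gt2 : 2 < #|hsplit n./2 (n - n./2)| by rewrite cG; lia.
split=> //; rewrite -{1}cG; first exact/fd_ge_sub2/hsplit_const.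
apply: (@fd_ge_sub2 (compl _)) => // c D cD Dc.
apply: (hsplit_const h1 h2 h3 (c := #|D| - c)) => // v vD.
by rewrite -(card_nbh_compl vD) Dc // addnK.
Qed.

Theorem theorem6 :
  (forall n : nat, 5 <= n ->
     [/\ (forall G : sgraph, #|G| = n ->
            3 <= fd G + fd (compl G) <= 2 * n - 4),
         (exists G : sgraph, #|G| = n /\ fd G + fd (compl G) = 3)
       & (exists G : sgraph, #|G| = n /\ fd G + fd (compl G) = 2 * n - 4)])
  /\
  (forall n : nat, 4 <= n ->
     [/\ (forall G : sgraph, #|G| = n ->
            2 <= fd G * fd (compl G) <= (n - 2) ^ 2),
         (exists G : sgraph, #|G| = n /\ fd G * fd (compl G) = 2)
       & (exists G : sgraph, #|G| = n /\ fd G * fd (compl G) = (n - 2) ^ 2)]).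
Proof.
split=> n n_ge.
- split=> [G nG||]; first by rewrite -nG; apply: fd_add_bounds; rewrite nG.
  + have cG : #|istar (n - 2)| = n by rewrite card_istar; lia.
    exists (istar (n - 2)); split=> //.
    have := @fd_compl_gt2 (istar (n - 2)); rewrite cG.
    by have := @fd_istar_le (n - 2); have := fd_compl_istar_le (n - 2); lia.
  + have [|G [cG f1 f2]] := @hsplit_fd n; first by lia.
    exists G; split=> //; have := @fd_add_bounds G; rewrite cG => /(_ n_ge)/andP[_].
    by move: (fd G) (fd (compl G)) f1 f2; lia.
- split=> [G nG||]; first by rewrite -nG; apply: fd_mul_bounds; rewrite nG.
  + have cG : #|istar (n - 2)| = n by rewrite card_istar; lia.
    exists (istar (n - 2)); split=> //.
    have := @fd_mul_bounds (istar (n - 2)); rewrite cG => /(_ n_ge)/andP[+ _].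
    have := @fd_istar_le (n - 2); have := fd_compl_istar_le (n - 2).
    by move: (fd _) (fd _) => a b; nia.
  + have [|G [cG f1 f2]] := @hsplit_fd n; first by lia.
    exists G; split=> //; have := @fd_mul_bounds G; rewrite cG => /(_ n_ge)/andP[_ le].
    by apply/eqP; rewrite eqn_leq le -mulnn leq_mul.
Qed.
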